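(* For every parameter vector $\bm{\theta}\in\mathbb{R}^D$, the gradient of the trace of the loss Hessian with respect to the input-to-hidden parameters $\bm{w}$ is $$\frac{\partial\,\mathrm{tr}(\bm{H}_L(\bm{\theta}))}{\partial\bm{w}}=\sum_{i=1}^I\Big(\bm{h}(\bm{x}_i)\otimes\big(\bm{\mathcal{W}}_i^{\mathrm{I}}+\bm{\mathcal{W}}_i^{\mathrm{II}}+\bm{\mathcal{W}}_i^{\mathrm{III}}\big)\Big)\in\mathbb{R}^{(M+1)N},$$ where $\bm{\mathcal{W}}_i^{\mathrm{I}},\bm{\mathcal{W}}_i^{\mathrm{II}},\bm{\mathcal{W}}_i^{\mathrm{III}}\in\mathbb{R}^N$ are $$\bm{\mathcal{W}}_i^{\mathrm{I}}=(1+\bm{x}_i^\top\bm{x}_i)\Big(s''(z_i)\bm{F}'(\bm{y}_i)\widetilde{\bm{V}}^\top\widetilde{\bm{V}}\bm{F}'(\bm{y}_i)+2s'(z_i)\,\mathrm{diag}(\widetilde{\bm{V}}^\top)\bm{F}''(\bm{y}_i)\Big)\bm{F}'(\bm{y}_i)\widetilde{\bm{V}}^\top,$$ $$\bm{\mathcal{W}}_i^{\mathrm{II}}=(1+\bm{x}_i^\top\bm{x}_i)\Big(s'(z_i)\bm{F}'(\bm{y}_i)\widetilde{\bm{V}}^\top\widetilde{\bm{V}}\bm{f}''(\bm{y}_i)+\delta_i\bm{F}'''(\bm{y}_i)\widetilde{\bm{V}}^\top\Big),$$ $$\bm{\mathcal{W}}_i^{\mathrm{III}}=s''(z_i)\b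ig(1+\bm{f}(\bm{y}_i)^\top\bm{f}(\bm{y}_i)\big)\bm{F}'(\bm{y}_i)\widetilde{\bm{V}}^\top+2s'(z_i)\bm{F}'(\bm{y}_i)\bm{f}(\bm{y}_i).$$
   Context: Network. Let $M,N,I\ge 1$ be integers and $f:\mathbb{R}\to\mathbb{R}$ a three times differentiable activation function with derivatives $f',f'',f'''$. For $\bm{y}\in\mathbb{R}^N$: $\bm{f}(\bm{y})=[f(y_1),\dots,f(y_N)]^\top$, and $\bm{f}',\bm{f}'',\bm{f}'''$ are defined entrywise in the same way; $\bm{F}'(\bm{y})=\mathrm{diag}(\bm{f}'(\bm{y}))$, $\bm{F}''(\bm{y})=\mathrm{diag}(\bm{f}''(\bm{y}))$, $\bm{F}'''(\bm{y})=\mathrm{diag}(\bm{f}'''(\bm{y}))$. For a vector $\bm{u}$, $\bm{h}(\bm{u})=[1\ \ \bm{u}^\top]^\top$. Parameters: $\bm{W}=[\bm{b}\ \ \widetilde{\bm{W}}]\in\mathbb{R}^{N\times(M+1)}$ with $\bm{b}\in\mathbb{R}^N$, $\widetilde{\bm{W}}\in\mathbb{R}^{N\times M}$, and $\bm{V}=[c\ \ \widetilde{\bm{V}}]\in\mathbb{R}^{1\times(N+1)}$ with $c\in\mathbb{R}$, $\widetilde{\bm{V}}\in\mathbb{R}^{1\times N}$. Let $\bm{w}\in\mathbb{R}^{(M+1)N}$ be the vertical concatenation of the columns of $\bm{W}$ (in order), $\bm{v}=\bm{V}^\top\in\mathbb{R}^{N+1}$, and $\bm{\theta}=[\bm{w}^\top\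 \bm{v}^\top]^\top\in\mathbb{R}^D$, $D=MN+2N+1$. For training data $\bm{x}_i\in\mathbb{R}^M$ with labels $q_i\in\{0,1\}$, $i=1,\dots,I$, put $\bm{y}_i=\bm{W}\bm{h}(\bm{x}_i)$, $z_i=\bm{V}\bm{h}(\bm{f}(\bm{y}_i))$, $p_i=s(z_i)$, where $s(z)=1/(1+e^{-z})$; then $s'(z_i)=p_i(1-p_i)$, $s''(z_i)=(1-2p_i)(1-p_i)p_i$; and $\delta_i=p_i-q_i$. Loss: $L(\bm{\theta})=-\sum_{i=1}^I\big(q_i\log p_i+(1-q_i)\log(1-p_i)\big)$. $\bm{H}_L(\bm{\theta})\in\mathbb{R}^{D\times D}$ is the Hessian of $L$ with respect to $\bm{\theta}$. The gradient of a scalar function is the column vector of its partial derivatives; $\otimes$ is the Kronecker product. *)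

(* Defs.v *)
From mathcomp Require Import all_boot all_order all_algebra.
From mathcomp Require Import mxtens.
From mathcomp Require Import all_classical all_reals all_analysis.

Set Implicit Arguments.
Unset Strict Implicit.
Unset Printing Implicit Defensive.

Import Order.TTheory GRing.Theory Num.Theory.
Import numFieldNormedType.Exports.

Local Open Scope classical_set_scope.
Local Open Scope ring_scope.

Section Calculus.
Context {R : realType} {n : nat}.
Implicit Types (g : 'cV[R]_n -> R) (u : 'cV[R]_n).

Definition partial (i : 'I_n) g : 'cV[R]_n -> R :=
  fun u => 'D_(delta_mx i 0) g u.

Definition has_partials g u := forall i : 'I_n, derivable g u (delta_mx i 0).

(* ['D_v g u] is a total limit operator: [gradient] and [hessian] are meaningful
   only where the corresponding existence predicate holds. *)
Definition gradient g u : 'cV[R]_n := \col_i partial i g u.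

Definition has_second_partials g u :=
  forall i : 'I_n, has_partials (partial i g) u.

Definition hessian g u : 'M[R]_n := \matrix_(i, j) partial i (partial j g) u.

End Calculus.

Lemma mxvec_index_tens m n (i : 'I_m) (j : 'I_n) :
  mxvec_index i j = mxtens_index (i, j).
Proof.
have idx (S T : eqType) (s : seq S) (t : seq T) a b : a \in s -> b \in t ->
    index (a, b) [seq (u, v) | u <- s, v <- t]
      = (index a s * size t + index b t)%N.
  move=> + bt; elim: s => //= c s IHs; rewrite inE index_cat eq_sym.
  have [<- _|nca /= /IHs ->] := eqVneq c a.
    by rewrite map_f // (index_map (f := pair c)) // => ? ? [].
  rewrite size_map mulSn addnA ifF //.
  by apply/negP => /mapP[d _ [e _]]; rewrite e eqxx in nca.
have rankE : enum_rank (i, j) = index (i, j) (enum {: 'I_m * 'I_n}) :> nat.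
  by rewrite -[in RHS](nth_enum_rank (i, j) (i, j)) index_uniq ?enum_uniq -?cardE.
apply/val_inj; rewrite /= rankE enumT unlock /= /prod_enum idx ?mem_enum //.
by rewrite !index_enum_ord size_enum_ord.
Qed.

Section Network.
Context {R : realType}.

Definition sigmoid (z : R) : R := 1 / (1 + expR (- z)).

Definition hvec n (u : 'cV[R]_n) : 'cV[R]_(1 + n) := col_mx 1%:M u.

Definition diagf n (g : R -> R) (y : 'cV[R]_n) : 'M[R]_n :=
  diag_mx (map_mx g y)^T.

Definition sqnorm n (u : 'cV[R]_n) : R := (u^T *m u) 0 0.

(* [mxvec] is row-major, so transposing first stacks the columns of [W]. *)
Definition stack_cols m n (W : 'M[R]_(m, n)) : 'cV[R]_(n * m) := (mxvec W^T)^T.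

Definition unstack_cols m n (w : 'cV[R]_(n * m)) : 'M[R]_(m, n) :=
  (vec_mx w^T)^T.

Lemma stack_colsK m n : cancel (@stack_cols m n) (@unstack_cols m n).
Proof. by move=> W; rewrite /unstack_cols !trmxK mxvecK trmxK. Qed.

Lemma unstack_colsK m n : cancel (@unstack_cols m n) (@stack_cols m n).
Proof. by move=> w; rewrite /stack_cols !trmxK vec_mxK trmxK. Qed.

Lemma stack_colsE m n (W : 'M[R]_(m, n)) i j :
  stack_cols W (mxtens_index (j, i)) 0 = W i j.
Proof. by rewrite -mxvec_index_tens mxE mxvecE mxE. Qed.

Section Model.
Context {M N : nat}.
(* The dimension is M * N + 2 * N + 1, split as (M + 1) * N for [w] followed by
   N + 1 for [v]. *)
Implicit Type theta : 'cV[R]_((1 + M) * N + (1 + N)).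

Definition wpar theta : 'cV[R]_((1 + M) * N) := usubmx theta.
Definition vpar theta : 'cV[R]_(1 + N) := dsubmx theta.
Definition Wmat theta : 'M[R]_(N, 1 + M) := unstack_cols (wpar theta).
Definition Vmat theta : 'rV[R]_(1 + N) := (vpar theta)^T.
Definition Vtilde theta : 'rV[R]_N := rsubmx (Vmat theta).

Context (f : R -> R).

Definition preact theta (x : 'cV[R]_M) : 'cV[R]_N := Wmat theta *m hvec x.

Definition logit theta (x : 'cV[R]_M) : R :=
  (Vmat theta *m hvec (map_mx f (preact theta x))) 0 0.

Definition prob theta (x : 'cV[R]_M) : R := sigmoid (logit theta x).

Definition loss I (x : 'I_I -> 'cV[R]_M) (q : 'I_I -> R) theta : R :=
  - \sum_(i < I) (q i * ln (prob theta (x i))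
                  + (1 - q i) * ln (1 - prob theta (x i))).

(* In the three definitions below, [F k] is diag(f^(k)(y)) and [s k] is the k-th
   derivative of the sigmoid at z. *)
Definition calW1 theta (x : 'cV[R]_M) : 'cV[R]_N :=
  let F k := diagf (derive1n k f) (preact theta x) in
  let s k := derive1n k sigmoid (logit theta x) in
  let V := Vtilde theta in
  (1 + sqnorm x) *:
    ((s 2%N *: (F 1%N *m V^T *m V *m F 1%N) + (2 * s 1%N) *: (diag_mx V *m F 2%N))
     *m F 1%N *m V^T).

Definition calW2 theta (x : 'cV[R]_M) (q : R) : 'cV[R]_N :=
  let y := preact theta x in
  let F k := diagf (derive1n k f) y in
  let s k := derive1n k sigmoid (logit theta x) in
  let V := Vtilde theta in
  let delta := prob theta x - q in
  (1 + sqnorm x) *: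
    (s 1%N *: (F 1%N *m V^T *m V *m map_mx (derive1n 2 f) y)
     + delta *: (F 3%N *m V^T)).

Definition calW3 theta (x : 'cV[R]_M) : 'cV[R]_N :=
  let y := preact theta x in
  let F k := diagf (derive1n k f) y in
  let s k := derive1n k sigmoid (logit theta x) in
  let V := Vtilde theta in
  (s 2%N * (1 + sqnorm (map_mx f y))) *: (F 1%N *m V^T)
  + (2 * s 1%N) *: (F 1%N *m map_mx f y).

End Model.
End Network.

(* Main.v *)
Require Import Defs.
From mathcomp Require Import all_boot all_order all_algebra.
From mathcomp Require Import mxtens ring.
From mathcomp Require Import all_classical all_reals all_analysis.
Import Order.TTheory GRing.Theory Num.Theory.
Import numFieldNormedType.Exports.
Local Open Scope classical_set_scope.
Local Open Scope ring_scope.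

(** The loss, its gradient and the trace of its Hessian are treated as functions
of the whole parameter vector that are differentiated along an arbitrary
direction [e]. Since cross entropy composed with the sigmoid has derivative
[s(z) - q], two differentiations give the Hessian form
[s'(z) dz(e) dz(e') + (s(z) - q) d2z(e, e')], summed over the data. On the
coordinate directions [dz] and [d2z] are explicit, and the trace becomes
[s'(z) (1 + |f(y)|^2 + (1 + |x|^2) sum_n (V_n f'(y_n))^2)
 + (s(z) - q) (1 + |x|^2) sum_n V_n f''(y_n)].
Differentiating once more along the entries of [W] gives the three vectors.
Only derivatives along lines occur, so [f'''] need not be continuous. *)

(** * Differentiation rules along a fixed direction *)

Section DirectionalDerivatives.
Context {R : realType}.

Lemma scale1_add0 (h : R) : h *: (1 : R) + 0 = h.
Proof. by rewrite addr0 [LHS]mulr1. Qed.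

(* A directional derivative only sees the restriction of the function to a line;
   this transfers it between different ambient spaces. *)
Lemma is_derive_line {U V W : normedModType R} (g : U -> W) (k : V -> W)
    u v u' v' d :
  (forall h : R, g (h *: v + u) = k (h *: v' + u')) ->
  is_derive u v g d -> is_derive u' v' k d.
Proof.
move=> gk [dg Dg].
have gk0 : g u = k u' by have := gk 0; rewrite !scale0r !add0r.
have quotE : (fun h : R => h^-1 *: ((g \o shift u) (h *: v) - g u)) =
             (fun h : R => h^-1 *: ((k \o shift u') (h *: v') - k u')).
  by apply: funext => h /=; rewrite /shift /= gk gk0.
by split; [rewrite /derivable -quotE | rewrite /derive -quotE].
Qed.

Context {V : normedModType R}.
Implicit Types (u v : V) (g k : V -> R).

(** Restricting [g] to the line through [u] along [v] reduces this to the one-variable chain rule,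
    so a derivative of [g] along [v] alone suffices. *)
Lemma is_derive_comp1 {g u v} {phi : R -> R} {dphi dg : R} :
  is_derive (g u) 1 phi dphi -> is_derive u v g dg ->
  is_derive u v (fun t => phi (g t)) (dphi * dg).
Proof.
move=> dphiP dgP.
apply: (@is_derive_line _ _ _ (phi \o (fun h : R => g (h *: v + u))) _ 0 1).
  by move=> h /=; rewrite scale1_add0.
apply: is_derive1_comp; first by rewrite scale0r add0r.
by apply: is_derive_line dgP => h; rewrite scale1_add0.
Qed.

Lemma is_derive_linear g u v :
  (forall h : R, g (h *: v + u) = h * g v + g u) -> is_derive u v g (g v).
Proof.
move=> glin.
apply: (@is_derive_line _ _ _ (fun h : R => h * g v + g u) _ 0 1).
  by move=> h; rewrite glin scale1_add0.
apply: is_derive_eq (is_deriveD (is_deriveM (is_derive_id _ _)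
  (is_derive_cst (g v) _ _)) (is_derive_cst (g u) _ _)) _.
by rewrite /GRing.scale /= mul0r add0r addr0 mulr1.
Qed.

(** With pointwise functions and ring products instead of scaling, this rule and the next ones
    assemble derivatives of explicit formulas by application. *)
Lemma is_deriveMr {g k u v} {dg dk : R} :
  is_derive u v g dg -> is_derive u v k dk ->
  is_derive u v (fun t => g t * k t) (dg * k u + g u * dk).
Proof.
move=> dgP dkP; apply: is_derive_eq (is_deriveM dgP dkP) _.
by rewrite /GRing.scale /= addrC [k u * _]mulrC.
Qed.

Lemma is_deriveDr {g k u v} {dg dk : R} :
  is_derive u v g dg -> is_derive u v k dk ->
  is_derive u v (fun t => g t + k t) (dg + dk).
Proof. exact: is_deriveD. Qed.

Lemma is_deriveDcst (c : R) {g u v} {dg : R} :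
  is_derive u v g dg -> is_derive u v (fun t => c + g t) dg.
Proof.
by move=> dgP; apply: is_derive_eq (is_deriveDr (is_derive_cst c u v) dgP) _;
  rewrite add0r.
Qed.

Lemma is_deriveMcst (c : R) {g u v} {dg : R} :
  is_derive u v g dg -> is_derive u v (fun t => c * g t) (c * dg).
Proof. exact: is_deriveZ. Qed.

Lemma is_derive_sumr {n} {g : 'I_n -> V -> R} {u v} {dg : 'I_n -> R} :
  (forall i, is_derive u v (g i) (dg i)) ->
  is_derive u v (fun t => \sum_i g i t) (\sum_i dg i).
Proof.
move=> /is_derive_sum; congr is_derive.
by apply: funext => t; rewrite fct_sumE.
Qed.

End DirectionalDerivatives.

(** * Derivatives of the sigmoid and of the cross entropy *)

Section Sigmoid.
Context {R : realType}.
Implicit Types z : R.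

Lemma sigmoid_gt0 z : 0 < sigmoid z.
Proof. by rewrite divr_gt0 // addr_gt0 // expR_gt0. Qed.

Lemma sigmoid_lt1 z : sigmoid z < 1.
Proof.
by rewrite /sigmoid ltr_pdivrMr ?addr_gt0 ?expR_gt0 // mul1r ltrDl expR_gt0.
Qed.

Lemma is_derive_sigmoid z :
  is_derive z 1 (@sigmoid R) (sigmoid z * (1 - sigmoid z)).
Proof.
have den_neq0 : 1 + expR (- z) != 0 by rewrite gt_eqF // addr_gt0 ?expR_gt0.
have dden : is_derive z 1 (fun t : R => 1 + expR (- t)) (expR (- z) * - 1).
  exact (is_deriveDcst 1
    (is_derive_comp1 (is_derive_expR (- z)) (is_deriveNid z 1))).
apply: is_derive_eq (is_deriveMcst 1
  (is_deriveV (f := fun t : R => 1 + expR (- t)) den_neq0 dden)) _.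
by rewrite /sigmoid /GRing.scale /=; field.
Qed.

Lemma derive1_sigmoid :
  derive1n 1 (@sigmoid R) = fun z => sigmoid z * (1 - sigmoid z).
Proof.
apply: funext => z; rewrite derive1n1 derive1E.
by case: (is_derive_sigmoid z).
Qed.

Lemma is_derive_derive1n {phi : R -> R} {k : nat} {z} :
  derivable (derive1n k phi) z 1 ->
  is_derive z 1 (derive1n k phi) (derive1n k.+1 phi z).
Proof. by move=> /derivableP; rewrite derive1nS derive1E. Qed.

Lemma is_derive_sigmoid_derive1n k z : (k < 2)%N ->
  is_derive z 1 (derive1n k (@sigmoid R)) (derive1n k.+1 sigmoid z).
Proof.
case: k => [|[|//]] _; apply: is_derive_derive1n.
  by case: (is_derive_sigmoid z).
rewrite derive1_sigmoid.
by case: (is_deriveMr (is_derive_sigmoid z) (is_deriveDcst 1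
  (is_deriveN (is_derive_sigmoid z)))).
Qed.

(** The factor [s (1 - s)] of the sigmoid derivative cancels the denominators of both logarithmic
    derivatives, leaving [c (1 - s) - (1 - c) s]. *)
Lemma is_derive_cross_entropy (c : R) z :
  is_derive z 1 (fun t => c * ln (sigmoid t) + (1 - c) * ln (1 - sigmoid t))
    (c - sigmoid z).
Proof.
have s0 := sigmoid_gt0 z; have s1 : 0 < 1 - sigmoid z.
  by rewrite subr_gt0 sigmoid_lt1.
have ds := is_derive_sigmoid z; have dC := is_deriveDcst 1 (is_deriveN ds).
apply: is_derive_eq (is_deriveDr
  (is_deriveMcst c (is_derive_comp1 (g := sigmoid) (is_derive1_ln s0) ds))
  (is_deriveMcst (1 - c) (is_derive_comp1 (g := fun t => 1 - sigmoid t)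
    (is_derive1_ln s1) dC))) _.
field.
by rewrite !gt_eqF.
Qed.

End Sigmoid.

(** * Directional derivatives of the logit *)

Section Network.
Context {R : realType} {M N : nat}.
Context (f : R -> R).
Context (hf : forall k : nat, (k < 3)%N ->
  forall t : R, derivable (derive1n k f) t 1).
Local Notation param := 'cV[R]_((1 + M) * N + (1 + N)).
Implicit Types (x : 'cV[R]_M) (theta e : param).

(** Columns of [W] are stacked in order, so its entry in row [n] and column [m] sits at
    [mxtens_index (m, n)], input index first. *)
Lemma preact_sum x theta n :
  preact theta x n 0 =
    \sum_m theta (lshift _ (mxtens_index (m, n))) 0 * hvec x m 0.
Proof.
rewrite mxE; apply: eq_bigr => m _; congr (_ * _).
by rewrite -[LHS]stack_colsE unstack_colsK mxE.
Qed.

Lemma sum_hvec_sqr x : \sum_m hvec x m 0 ^+ 2 = 1 + sqnorm x.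
Proof.
rewrite big_split_ord big_ord1 /= col_mxEu mxE expr1n; congr (_ + _).
by rewrite /sqnorm mxE; apply: eq_bigr => m _; rewrite col_mxEd mxE expr2.
Qed.

Lemma Vtilde_vpar theta n : Vtilde theta 0 n = vpar theta (rshift 1 n) 0.
Proof. by rewrite !mxE. Qed.

Lemma logit_sum x theta :
  logit f theta x = vpar theta (lshift N ord0) 0
    + \sum_n Vtilde theta 0 n * f (preact theta x n 0).
Proof.
rewrite /logit mxE big_split_ord big_ord1 /=; congr (_ + _).
  by rewrite col_mxEu !mxE mulr1.
apply: eq_bigr => n _.
by rewrite col_mxEd [map_mx _ _ _ _]mxE [Vtilde _ _ _]mxE.
Qed.

Lemma is_derive_bias theta e :
  is_derive theta e (fun t : param => vpar t (lshift N ord0) 0)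
    (vpar e (lshift N ord0) 0).
Proof.
apply: (@is_derive_linear _ _
  (fun t : param => vpar t (lshift N ord0) 0)).
by move=> h; rewrite !mxE.
Qed.

Lemma is_derive_Vtilde n theta e :
  is_derive theta e (fun t : param => Vtilde t 0 n) (Vtilde e 0 n).
Proof.
apply: (@is_derive_linear _ _ (fun t : param => Vtilde t 0 n)).
by move=> h; rewrite !mxE.
Qed.

Lemma is_derive_preact x n theta e :
  is_derive theta e (fun t : param => preact t x n 0) (preact e x n 0).
Proof.
apply: (@is_derive_linear _ _ (fun t : param => preact t x n 0)).
move=> h; rewrite !preact_sum mulr_sumr -big_split /=.
by apply: eq_bigr => m _; rewrite !mxE mulrDl mulrA.
Qed.

Lemma is_derive_activation k x n theta e : (k < 3)%N ->
  is_derive theta e (fun t : param => derive1n k f (preact t x n 0))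
    (derive1n k.+1 f (preact theta x n 0) * preact e x n 0).
Proof.
move=> k_lt3.
exact: is_derive_comp1 (is_derive_derive1n (hf k k_lt3 _))
  (is_derive_preact x n theta e).
Qed.

(** Since [vpar], [Vtilde] and [preact] are linear in the parameters, their values at [e] are their
    derivatives along [e]. *)
Definition dlogit x theta e : R :=
  vpar e (lshift N ord0) 0
  + \sum_n (Vtilde e 0 n * f (preact theta x n 0)
      + Vtilde theta 0 n
        * (derive1n 1 f (preact theta x n 0) * preact e x n 0)).

(** A symmetric form in [e] and [e']: two mixed terms between output and input weights, and one term
    from the curvature of [f]. *)
Definition d2logit x theta e e' : R :=
  \sum_n (Vtilde e 0 n * (derive1n 1 f (preact theta x n 0) * preact e' x n 0)
    + Vtilde e' 0 n * (derive1n 1 f (preact theta x n 0) * preact e x n 0)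
    + Vtilde theta 0 n * (derive1n 2 f (preact theta x n 0)
                          * preact e x n 0 * preact e' x n 0)).

Lemma is_derive_logit x theta e :
  is_derive theta e (fun t : param => logit f t x) (dlogit x theta e).
Proof.
rewrite (funext (logit_sum x)).
apply: is_deriveDr (is_derive_bias _ _) (is_derive_sumr _) => n.
exact: is_deriveMr (is_derive_Vtilde _ _ _)
  (is_derive_activation 0 x n theta e isT).
Qed.

Lemma is_derive_dlogit x theta e e' :
  is_derive theta e' (fun t : param => dlogit x t e) (d2logit x theta e e').
Proof.
apply: is_deriveDcst; apply: is_derive_sumr => n.
have df k (k_lt3 : (k < 3)%N) := is_derive_activation k x n theta e' k_lt3.
(* The first direction [e] is held fixed, so [Vtilde e] and [preact e] are constants here; order 0
   in [df] is [f] itself. *)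
apply: is_derive_eq (is_deriveDr (is_deriveMcst (Vtilde e 0 n) (df 0%N isT))
  (is_deriveMr (is_derive_Vtilde n theta e')
    (is_deriveMr (df 1%N isT) (is_derive_cst (preact e x n 0) _ _)))) _.
by rewrite /cst; ring.
Qed.

(** * Gradient, Hessian and Hessian trace of the loss *)

Section Loss.
Context {I : nat} (x : 'I_I -> 'cV[R]_M) (q : 'I_I -> R).

Definition dloss theta e : R :=
  \sum_i (prob f theta (x i) - q i) * dlogit (x i) theta e.

(** The first summand is the Gauss-Newton part; the second weights the curvature of the logit by the
    residual. *)
Definition d2loss theta e e' : R :=
  \sum_i (derive1n 1 sigmoid (logit f theta (x i))
      * dlogit (x i) theta e' * dlogit (x i) theta e
    + (prob f theta (x i) - q i) * d2logit (x i) theta e e').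

Lemma is_derive_prob y theta e :
  is_derive theta e (fun t : param => prob f t y)
    (derive1n 1 sigmoid (logit f theta y) * dlogit y theta e).
Proof.
exact: is_derive_comp1 (is_derive_sigmoid_derive1n 0 _ isT)
  (is_derive_logit y theta e).
Qed.

Lemma is_derive_residual y c theta e :
  is_derive theta e (fun t : param => prob f t y - c)
    (derive1n 1 sigmoid (logit f theta y) * dlogit y theta e).
Proof.
apply: is_derive_eq (is_deriveDr (is_derive_prob y theta e)
  (is_derive_cst (- c) _ _)) _.
by rewrite addr0.
Qed.

Lemma is_derive_loss theta e :
  is_derive theta e (loss f x q) (dloss theta e).
Proof.
have dterm i := is_derive_comp1 (is_derive_cross_entropy (q i) _)
  (is_derive_logit (x i) theta e).
apply: is_derive_eq (is_deriveN (is_derive_sumr dterm)) _.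
by rewrite -sumrN; apply: eq_bigr => i _; rewrite -mulNr opprB.
Qed.

Lemma is_derive_dloss theta e e' :
  is_derive theta e' (fun t : param => dloss t e) (d2loss theta e e').
Proof.
apply: is_derive_sumr => i.
exact: is_deriveMr (is_derive_residual _ _ _ _) (is_derive_dlogit _ _ _ _).
Qed.

(** An equality of functions, because the partial derivative is differentiated again. *)
Lemma partial_loss k :
  partial k (loss f x q) = fun theta => dloss theta (delta_mx k 0).
Proof.
by apply: funext => theta; case: (is_derive_loss theta (delta_mx k 0)).
Qed.

Lemma hessian_loss theta j k :
  hessian (loss f x q) theta j k = d2loss theta (delta_mx k 0) (delta_mx j 0).
Proof.
rewrite mxE partial_loss.
by case: (is_derive_dloss theta (delta_mx k 0) (delta_mx j 0)).
Qed.

(** Perturbing one entry of [W] moves only the preactivation of its row. *)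
Lemma preact_delta_w y m n k :
  preact (delta_mx (lshift _ (mxtens_index (m, n))) 0 : param) y k 0
    = hvec y m 0 * (k == n)%:R.
Proof.
rewrite preact_sum (bigD1 m) //= big1 => [|j neq_jm].
  rewrite mxE eqxx andbT addr0 (inj_eq (@lshift_inj _ _)).
  by rewrite (can_eq (@mxtens_indexK _ _)) xpair_eqE eqxx mulrC.
rewrite mxE eqxx andbT (inj_eq (@lshift_inj _ _)).
by rewrite (can_eq (@mxtens_indexK _ _)) xpair_eqE (negPf neq_jm) mul0r.
Qed.

Lemma preact_delta_v y j k :
  preact (delta_mx (rshift _ j) 0 : param) y k 0 = 0.
Proof.
by rewrite preact_sum big1 // => m _; rewrite mxE eq_lrshift mul0r.
Qed.

Lemma vpar_delta_w i j : vpar (delta_mx (lshift _ i) 0 : param) j 0 = 0.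
Proof. by rewrite !mxE eq_rlshift. Qed.

Lemma vpar_delta_v i j :
  vpar (delta_mx (rshift _ i) 0 : param) j 0 = (j == i)%:R.
Proof. by rewrite !mxE eq_rshift andbT. Qed.

Lemma dlogit_w y theta m n :
  dlogit y theta (delta_mx (lshift _ (mxtens_index (m, n))) 0)
    = hvec y m 0 * (Vtilde theta 0 n * derive1n 1 f (preact theta y n 0)).
Proof.
rewrite /dlogit vpar_delta_w add0r (bigD1 n) //= big1 => [|k /negPf neq_kn];
  rewrite preact_delta_w Vtilde_vpar vpar_delta_w ?eqxx ?neq_kn /=; ring.
Qed.

Lemma dlogit_c y theta :
  dlogit y theta (delta_mx (rshift _ (lshift N ord0)) 0) = 1.
Proof.
rewrite /dlogit vpar_delta_v eqxx big1 ?addr0 // => n _.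
by rewrite preact_delta_v Vtilde_vpar vpar_delta_v eq_rlshift /=; ring.
Qed.

Lemma dlogit_v y theta n :
  dlogit y theta (delta_mx (rshift _ (rshift 1 n)) 0) = f (preact theta y n 0).
Proof.
rewrite /dlogit vpar_delta_v eq_lrshift add0r (bigD1 n) //=.
rewrite big1 => [|k /negPf neq_kn]; rewrite preact_delta_v Vtilde_vpar
  vpar_delta_v eq_rshift ?eqxx ?neq_kn /=; ring.
Qed.

Lemma d2logit_w y theta m n :
  let e := delta_mx (lshift _ (mxtens_index (m, n))) 0 in
  d2logit y theta e e
    = hvec y m 0 ^+ 2 * (Vtilde theta 0 n * derive1n 2 f (preact theta y n 0)).
Proof.
rewrite /d2logit (bigD1 n) //= big1 => [|k /negPf neq_kn];
  rewrite preact_delta_w Vtilde_vpar vpar_delta_w ?eqxx ?neq_kn /=; ring.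
Qed.

(** The logit is affine in the output weights, hence has no curvature along them. *)
Lemma d2logit_v y theta j :
  let e := delta_mx (rshift _ j) 0 in d2logit y theta e e = 0.
Proof.
by rewrite /d2logit big1 // => n _; rewrite preact_delta_v; ring.
Qed.

(** Separates the three kinds of coordinates on which [dlogit] is explicit: entries of [W], output
    bias, entries of [Vtilde]. *)
Lemma sum_param (F : 'I_((1 + M) * N + (1 + N)) -> R) :
  \sum_k F k = \sum_m \sum_n F (lshift _ (mxtens_index (m, n)))
    + (F (rshift _ (lshift N ord0)) + \sum_n F (rshift _ (rshift 1 n))).
Proof.
rewrite big_split_ord; congr (_ + _); last by rewrite big_split_ord big_ord1.
rewrite pair_bigA /= (reindex (@mxtens_index (1 + M) N)) /=.
  by apply: eq_bigr => -[].
by exists (@mxtens_unindex _ _) => k _;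
  rewrite (mxtens_indexK, mxtens_unindexK).
Qed.

(** In the first factor, the 1 comes from the output bias, the squares of [f] from [Vtilde], and the
    remaining sum from [W]. *)
Definition trace_term y c theta : R :=
  derive1n 1 sigmoid (logit f theta y)
    * (1 + \sum_n f (preact theta y n 0) ^+ 2
       + (1 + sqnorm y) * \sum_n (Vtilde theta 0 n
                                  * derive1n 1 f (preact theta y n 0)) ^+ 2)
  + (prob f theta y - c)
    * ((1 + sqnorm y) * \sum_n Vtilde theta 0 n
                               * derive1n 2 f (preact theta y n 0)).

Lemma trace_hessian_loss theta :
  \tr (hessian (loss f x q) theta) = \sum_i trace_term (x i) (q i) theta.
Proof.
rewrite /mxtrace; under eq_bigr do rewrite hessian_loss.
rewrite /d2loss exchange_big; apply: eq_bigr => i _.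
rewrite sum_param; set s1 := derive1n 1 sigmoid _; set delta := prob _ _ _ - _.
(* Each summand carries the square of entry [m] of [hvec]; pulling it out separates the double sum,
   and [sum_hvec_sqr] evaluates the outer one. *)
under eq_bigr => m _.
  under eq_bigr => n _.
    rewrite dlogit_w d2logit_w.
    rewrite [X in X + _](_ : _ = hvec (x i) m 0 ^+ 2
      * (s1 * (Vtilde theta 0 n * derive1n 1 f (preact theta (x i) n 0)) ^+ 2));
      last by ring.
    rewrite [delta * _]mulrCA -mulrDr.
    over.
  rewrite -mulr_sumr.
  over.
under [in X in _ + (_ + X)]eq_bigr => n _.
  rewrite dlogit_v d2logit_v mulr0 addr0 -mulrA -expr2.
  over.
rewrite dlogit_c d2logit_v -mulr_suml sum_hvec_sqr big_split /= -!mulr_sumr.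
by rewrite /trace_term -/s1 -/delta; ring.
Qed.

End Loss.

(** Directions inside the [w] block leave [Vtilde] fixed, so only the logit and the preactivations
    vary; [f'''] enters through the residual term. *)
Lemma is_derive_trace_term y c theta e : Vtilde e = 0 ->
  is_derive theta e (trace_term y c)
    (derive1n 2 sigmoid (logit f theta y) * dlogit y theta e
       * (1 + \sum_n f (preact theta y n 0) ^+ 2
          + (1 + sqnorm y) * \sum_n (Vtilde theta 0 n
                                     * derive1n 1 f (preact theta y n 0)) ^+ 2)
     + derive1n 1 sigmoid (logit f theta y)
       * (\sum_n 2 * f (preact theta y n 0)
                   * (derive1n 1 f (preact theta y n 0) * preact e y n 0)
          + (1 + sqnorm y) * \sum_n 2 * Vtilde theta 0 n ^+ 2
              * derive1n 1 f (preact theta y n 0)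
              * (derive1n 2 f (preact theta y n 0) * preact e y n 0))
     + (derive1n 1 sigmoid (logit f theta y) * dlogit y theta e
          * ((1 + sqnorm y) * \sum_n Vtilde theta 0 n
                                     * derive1n 2 f (preact theta y n 0))
        + (prob f theta y - c)
          * ((1 + sqnorm y) * \sum_n Vtilde theta 0 n
              * (derive1n 3 f (preact theta y n 0) * preact e y n 0)))).
Proof.
move=> Ve0.
have df k n (k_lt3 : (k < 3)%N) := is_derive_activation k y n theta e k_lt3.
have dVf k n (k_lt3 : (k < 3)%N) : is_derive theta e
    (fun t : param => Vtilde t 0 n * derive1n k f (preact t y n 0))
    (Vtilde theta 0 n
     * (derive1n k.+1 f (preact theta y n 0) * preact e y n 0)).
  apply: is_derive_eq
    (is_deriveMr (is_derive_Vtilde n theta e) (df k n k_lt3)) _.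
  by rewrite Ve0 mxE mul0r add0r.
have dsqr (g : param -> R) dg : is_derive theta e g dg ->
    is_derive theta e (fun t => g t ^+ 2) (2 * g theta * dg).
  by move=> dgP; apply: is_derive_eq (is_deriveMr dgP dgP) _; ring.
apply: is_deriveDr; apply: is_deriveMr.
- exact: is_derive_comp1 (is_derive_sigmoid_derive1n 1 _ isT)
    (is_derive_logit y theta e).
- apply: is_deriveDr.
    apply: is_deriveDcst; apply: is_derive_sumr => n.
    exact: dsqr (df 0%N n isT).
  apply: is_deriveMcst; apply: is_derive_sumr => n.
  by apply: is_derive_eq (dsqr _ _ (dVf 1%N n isT)) _; ring.
- exact: is_derive_residual.
- apply: is_deriveMcst; apply: is_derive_sumr => n.
  exact: dVf.
Qed.

End Network.

(** * Entries of the three vectors in the gradient formula *)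

Section WeightGradient.
Context {R : realType} {M N : nat} (f : R -> R).
Local Notation param := 'cV[R]_((1 + M) * N + (1 + N)).
Implicit Types (y : 'cV[R]_M) (theta : param).

Lemma diag_mulmx_entry p (d : 'rV[R]_N) (A : 'M[R]_(N, p)) n j :
  (diag_mx d *m A) n j = d 0 n * A n j.
Proof. by rewrite mul_diag_mx mxE. Qed.

Lemma diagf_mulmx p g (u : 'cV[R]_N) (A : 'M[R]_(N, p)) n j :
  (diagf g u *m A) n j = g (u n 0) * A n j.
Proof. by rewrite diag_mulmx_entry !mxE. Qed.

Lemma trmx_mul_row (V : 'rV[R]_N) (A : 'M[R]_(1, 1)) n :
  (V^T *m A) n 0 = V 0 n * A 0 0.
Proof. by rewrite mxE big_ord1 mxE. Qed.

Lemma tensmx_col_entry p r (A : 'cV[R]_p) (B : 'cV[R]_r) i j :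
  (A *t B) (mxtens_index (i, j)) 0 = A i 0 * B j 0.
(* The product has [1 * 1] columns, so the index 0 must be identified with [mxtens_index (0, 0)]. *)
Proof. by rewrite -tensmxE; congr (_ _); apply/val_inj. Qed.

(** One rule per operation, so that the entry of a product is expanded into a sum only where that
    sum is wanted. *)
Lemma scalemx_entry p r a (A : 'M[R]_(p, r)) i j : (a *: A) i j = a * A i j.
Proof. by rewrite mxE. Qed.

Lemma addmx_entry p r (A B : 'M[R]_(p, r)) i j : (A + B) i j = A i j + B i j.
Proof. by rewrite mxE. Qed.

Lemma scale_mulmx_entry p r s a (A : 'M[R]_(p, r)) (B : 'M[R]_(r, s)) i j :
  ((a *: A) *m B) i j = a * (A *m B) i j.
Proof. by rewrite -scalemxAl mxE. Qed.

Lemma trmx_entry p r (A : 'M[R]_(p, r)) i j : A^T j i = A i j.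
Proof. by rewrite mxE. Qed.

(** Associated to the right, the first product contains the [1 x 1] matrix [V F' F' V^T], which is
    the sum of squares; the other factors act entrywise. *)
Lemma calW1E theta y n :
  calW1 f theta y n 0 = (1 + sqnorm y)
    * (derive1n 2 sigmoid (logit f theta y)
         * (\sum_k (Vtilde theta 0 k * derive1n 1 f (preact theta y k 0)) ^+ 2)
         * (derive1n 1 f (preact theta y n 0) * Vtilde theta 0 n)
       + 2 * derive1n 1 sigmoid (logit f theta y) * Vtilde theta 0 n ^+ 2
         * derive1n 1 f (preact theta y n 0)
         * derive1n 2 f (preact theta y n 0)).
Proof.
rewrite /calW1; cbv beta zeta.
(* Otherwise unification and [ring] compare the iterated derivatives by
   conversion, which takes minutes. *)
move: (derive1n 1 sigmoid _) (derive1n 2 sigmoid _) => s1 s2.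
move: (derive1n 1 f) (derive1n 2 f) => f1 f2.
rewrite scalemx_entry -mulmxA mulmxDl addmx_entry !scale_mulmx_entry -!mulmxA.
rewrite diagf_mulmx trmx_mul_row diag_mulmx_entry.
rewrite !diagf_mulmx trmx_entry [(_ *m _) 0 0]mxE.
under eq_bigr => k _.
  rewrite !diagf_mulmx trmx_entry.
  rewrite (_ : _ * _ = (Vtilde theta 0 k
    * f1 (preact theta y k 0)) ^+ 2); last by ring.
  over.
by ring.
Qed.

Lemma calW2E theta y c n :
  calW2 f theta y c n 0 = (1 + sqnorm y)
    * (derive1n 1 sigmoid (logit f theta y)
         * (\sum_k Vtilde theta 0 k * derive1n 2 f (preact theta y k 0))
         * (derive1n 1 f (preact theta y n 0) * Vtilde theta 0 n)
       + (prob f theta y - c)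
         * (derive1n 3 f (preact theta y n 0) * Vtilde theta 0 n)).
Proof.
rewrite /calW2 -!mulmxA !scalemx_entry !addmx_entry !scalemx_entry.
rewrite !diagf_mulmx trmx_mul_row trmx_entry [(_ *m _) 0 0]mxE.
under eq_bigr => k _ do rewrite [map_mx _ _ _ _]mxE.
by ring.
Qed.

Lemma calW3E theta y n :
  calW3 f theta y n 0 =
    derive1n 2 sigmoid (logit f theta y)
      * (1 + \sum_k f (preact theta y k 0) ^+ 2)
      * (derive1n 1 f (preact theta y n 0) * Vtilde theta 0 n)
    + 2 * derive1n 1 sigmoid (logit f theta y)
      * (derive1n 1 f (preact theta y n 0) * f (preact theta y n 0)).
Proof.
rewrite /calW3 !addmx_entry !scalemx_entry !diagf_mulmx trmx_entry.
rewrite [map_mx _ _ _ _]mxE /sqnorm [(_ *m _) 0 0]mxE.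
under eq_bigr => k _ do rewrite trmx_entry [map_mx _ _ _ _]mxE -expr2.
by ring.
Qed.

End WeightGradient.

(** * The gradient of the Hessian trace along the input weights *)

Theorem theorem2 (R : realType) (M N I : nat)
    (hM : (1 <= M)%N) (hN : (1 <= N)%N) (hI : (1 <= I)%N)
    (f : R -> R)
    (hf : forall k : nat, (k < 3)%N -> forall t : R, derivable (derive1n k f) t 1)
    (x : 'I_I -> 'cV[R]_M) (q : 'I_I -> R)
    (hq : forall i, q i = 0 \/ q i = 1)
    (theta : 'cV[R]_((1 + M) * N + (1 + N))) :
  let trH := fun w : 'cV[R]_((1 + M) * N) =>
    \tr (hessian (loss f x q) (col_mx w (vpar theta))) in
  [/\ has_partials (loss f x q) theta,
      has_second_partials (loss f x q) theta,
      has_partials trH (wpar theta) &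
      gradient trH (wpar theta) =
        \sum_(i < I) (hvec (x i) *t
          (calW1 f theta (x i) + calW2 f theta (x i) (q i)
           + calW3 f theta (x i)))].
Proof.
move=> trH.
have dtrH m n : is_derive (wpar theta) (delta_mx (mxtens_index (m, n)) 0) trH
    (\sum_i hvec (x i) m 0 * (calW1 f theta (x i) n 0
       + calW2 f theta (x i) (q i) n 0 + calW3 f theta (x i) n 0)).
  (* The same coordinate direction, lifted from the [w] block to the whole parameter space. *)
  set e : 'cV[R]_((1 + M) * N + (1 + N)) :=
    delta_mx (lshift _ (mxtens_index (m, n))) 0.
  have Ve0 : Vtilde e = 0.
    by apply/rowP => k; rewrite Vtilde_vpar vpar_delta_w mxE.
  (* On the line through [theta] along [e], the closed form of the trace agrees with [trH], so its
     derivative transfers. *)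
  apply: (@is_derive_line _ _ _ _
    (fun t => \sum_i trace_term f (x i) (q i) t) _ theta e).
    move=> h; rewrite /trH (trace_hessian_loss f hf); apply: eq_bigr => i _.
    congr trace_term; rewrite -[LHS]vsubmxK -[RHS]vsubmxK col_mxKu col_mxKd.
    congr col_mx; apply/colP => j.
      by rewrite !mxE (inj_eq (@lshift_inj _ _)).
    by rewrite !mxE eq_rlshift mulr0 add0r.
  apply: is_derive_eq (is_derive_sumr
    (fun i => is_derive_trace_term f hf (x i) (q i) theta e Ve0)) _.
  apply: eq_bigr => i _.
  (* Terms with the factor [1 + sqnorm] go to [calW1] when they come from the squared sum and to
     [calW2] when they come from the residual product; the rest is [calW3]. *)
  rewrite calW1E calW2E calW3E dlogit_w.
  move: (derive1n 1 sigmoid _) (derive1n 2 sigmoid _) => s1 s2.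
  move: (derive1n 1 f) (derive1n 2 f) (derive1n 3 f) => f1 f2 f3.
  (* Only preactivation [n] moves along [e], so each differentiated sum collapses to one term. *)
  have pick (F G : 'I_N -> R) :
      \sum_k F k * (G k * preact e (x i) k 0) = F n * G n * hvec (x i) m 0.
    rewrite (bigD1 n) //= big1 => [|k /negPf neq_kn];
      rewrite preact_delta_w ?eqxx ?neq_kn /=; ring.
  rewrite !pick.
  by ring.
split.
- by move=> k; case: (is_derive_loss f hf x q theta (delta_mx k 0)).
- move=> j k; rewrite (partial_loss f hf).
  by case: (is_derive_dloss f hf x q theta (delta_mx j 0) (delta_mx k 0)).
- by move=> k; case: (mxtens_indexP k) => m n; case: (dtrH m n).
- apply/colP => k; case: (mxtens_indexP k) => m n.
  rewrite mxE summxE /partial; case: (dtrH m n) => _ ->; apply: eq_bigr => i _.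
  by rewrite [RHS]tensmx_col_entry !addmx_entry.
Qed.
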